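(* Let $f:\mathbb{N}\to\mathbb{C}$ be essentially bounded. Let $x$ range over positive integers and let $h=h(x)$, $H=H(x)$, $Q=Q(x)$ be positive integers with $h\le H<Q$, $Q\ll x$ and $H=o(x)$ as $x\to\infty$. Let $g:\mathbb{N}\to\mathbb{C}$ be a sieve function of range $Q$ with Eratosthenes transform $g'$. Then for every $\varepsilon>0$, as $x\to\infty$, $$\sum_{1\le a\le H}\ \sum_{x<n\le x+h}f(n)g(n-a)=\Bigg(H\sum_{q\le h}\frac{g'(q)}{q}+\sum_{h<q\le H}g'(q)\Big[\frac{H}{q}\Big]+\sum_{\substack{h<q\le Q\\ \{x/q\}\le\{H/q\}}}g'(q)\Bigg)\sum_{x<n\le x+h}f(n)+O_{\varepsilon}\big(x^{\varepsilon}h^2\big).$$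
   Context: An arithmetic function $f:\mathbb{N}\to\mathbb{C}$ is essentially bounded if for every $\varepsilon>0$, $f(n)\ll_\varepsilon n^\varepsilon$ as $n\to\infty$. A function $g:\mathbb{N}\to\mathbb{C}$ is a sieve function of range $Q$ if $g(n)=\sum_{q\mid n,\,q\le Q}g'(q)$ for all $n$, where $g'=g\ast\mu$ (Dirichlet convolution with the Möbius function), called the Eratosthenes transform of $g$, is supported on $[1,Q]$ and satisfies $g'(q)\ll_\varepsilon q^\varepsilon$ for every $\varepsilon>0$ (uniformly, with constants independent of $x$). $[t]$ denotes the integer part and $\{t\}=t-[t]$ the fractional part of $t$. Sums over $q$ run over positive integers. The implied $O_\varepsilon$-constant depends on $\varepsilon$ (and the data $f$, $g'$ bounds and the constant in $Q\ll x$), not on $x,h,H,Q$. *)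

(* Defs.v *)
From HB Require Import structures.
From mathcomp Require Import all_boot all_order all_algebra.
From mathcomp Require Import all_classical all_reals all_analysis.
From mathcomp Require Import complex.

Set Implicit Arguments.
Unset Strict Implicit.
Unset Printing Implicit Defensive.

Import Order.TTheory GRing.Theory Num.Theory.
Import numFieldNormedType.Exports.

Local Open Scope ring_scope.
Local Open Scope classical_set_scope.
Local Open Scope complex_scope.

(* Arithmetic functions are encoded as functions on nat; their value at 0 is
   never constrained and plays no role. *)

Definition squarefree (n : nat) : bool :=
  all (fun p => logn p n == 1%N) (primes n).

Definition mobius (n : nat) : int :=
  if squarefree n then (-1) ^+ size (primes n) else 0.

Definition dirichlet_conv (A : pzRingType) (u v : nat -> A) (n : nat) : A :=
  \sum_(d <- divisors n) u d * v (n %/ d)%N.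

Definition eratosthenes (A : pzRingType) (g : nat -> A) : nat -> A :=
  dirichlet_conv g (fun n => (mobius n)%:~R).

(* The order on R[i] compares real parts of numbers with equal imaginary
   parts, so the inequality says that the modulus of f n is at most C * n ^ e. *)
Definition essentially_bounded (R : realType) (f : nat -> R[i]) : Prop :=
  forall e : R, 0 < e ->
    exists C : R, \forall n \near \oo, `|f n| <= (C * n%:R `^ e)%:C.

(* The function B records the constants in g'(q) <<_e q ^ e, so that they can be
   shared by a family of sieve functions of varying range. *)
Definition sieve_function (R : realType) (B : R -> R) (Q : nat)
    (g : nat -> R[i]) : Prop :=
  [/\ forall n, (0 < n)%N ->
        g n = \sum_(q <- divisors n | (q <= Q)%N) eratosthenes g q,
      forall q, (Q < q)%N -> eratosthenes g q = 0
    & forall e : R, 0 < e -> forall q, (0 < q)%N ->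
        `|eratosthenes g q| <= (B e * q%:R `^ e)%:C].

Definition frac_part (R : realType) (t : R) : R := t - (Num.floor t)%:~R.

(* Main.v *)
Require Import Defs.
From mathcomp Require Import all_boot all_order all_algebra zify ring.
From mathcomp Require Import all_classical all_reals all_analysis.
From mathcomp Require Import complex.

Import Order.TTheory GRing.Theory Num.Theory.
Import numFieldNormedType.Exports.

Local Open Scope ring_scope.
Local Open Scope classical_set_scope.
Local Open Scope complex_scope.

(* Opening g(n - a) over the divisors q <= Q turns the inner sum over a into the
   number of multiples of q in [n - H, n - 1]. For q <= h this is H / q + O(1).
   For q > h, moving the window to [x - H + 1, x] changes the count by at most
   the number of multiples of q in (x, x + h] and (x - H, x - H + h], and there
   the count is [H / q] plus the indicator of x mod q < H mod q. This condition
   differs from the one with <= only when q divides x - H. All these errors are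
   sums over the divisors of O(h) integers of size O(x), so the divisor bound
   d(m) << m ^ d concludes. *)

(** * The divisor bound *)

(** [divisors] folds over the prime decomposition; for a factor p ^ k it iterates k times a merge
    with the list it started from, so the size is multiplied by k + 1. *)
Lemma size_divisors (n : nat) :
  size (divisors n) = (\prod_(f <- prime_decomp n) f.2.+1)%N.
Proof.
rewrite /divisors; elim: (prime_decomp n) => [|[p k] s IHs]; first by rewrite big_nil.
rewrite big_cons -IHs /=; move: (foldr _ _ s) => t; elim: k => [|k IHk] /=.
  by rewrite mul1n.
by rewrite size_merge size_cat size_map IHk; lia.
Qed.

Lemma powR_prod_pfactor (R : realType) (s : seq (nat * nat)) (d : R) :
  (\prod_(f <- s) f.1 ^ f.2)%N%:R `^ d =
  \prod_(f <- s) (f.1%:R `^ d) ^+ f.2.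
Proof.
elim: s => [|[p k] s IHs]; first by rewrite !big_nil powR1.
rewrite !big_cons natrM powRM ?ler0n // IHs natrX /=.
congr (_ * _).
by rewrite -(powR_mulrn k (ler0n R p)) -(powR_mulrn k (powR_ge0 _ _)) -!powRrM mulrC.
Qed.

(* The factor k + 1 at p ^ k is at most p ^ (d k) once p ^ d >= 2, and at most
   M 2 ^ (d k) with M depending on d only for each of the finitely many smaller
   primes. *)
Lemma divisor_bound (R : realType) (d : R) : 0 < d ->
  exists2 C : R, 0 <= C &
    forall n, (0 < n)%N -> (size (divisors n))%:R <= C * n%:R `^ d.
Proof.
move=> d0; have ln20 : 0 < ln (2%:R : R) by rewrite ln_gt0// ltr1n.
have dl0 : 0 < d * ln 2 by rewrite mulr_gt0.
(* With t = d ln 2, M (1 + k t) = k + 1 + 1/t + k t >= k + 1, and 1 + k t <= exp (k t) = 2 ^ (d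
   k). *)
pose M : R := 1 + (d * ln 2)^-1.
have M1 : 1 <= M by rewrite lerDl invr_ge0 ltW.
(* [T] exceeds 2 ^ (1/d), so p >= T forces p ^ d >= 2. *)
pose T := (Num.trunc (2 `^ d^-1 : R)).+1.
have HT p : (T <= p)%N -> 2 <= p%:R `^ d :> R.
  move=> Tp; have : 2 `^ d^-1 <= p%:R :> R.
    apply: ltW; apply: lt_le_trans (truncnS_gt _) _.
    by rewrite ler_nat.
  move=> /(ge0_ler_powR (ltW d0)); rewrite !nnegrE powR_ge0 ler0n => /(_ isT isT).
  by rewrite -powRrM mulVf ?gt_eqF// powRr1.
have Hs p k : (1 < p)%N -> k.+1%:R <= M * (p%:R `^ d) ^+ k :> R.
  move=> p1; have h2 : 2 `^ d <= p%:R `^ d :> R.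
    by apply: ge0_ler_powR; rewrite ?nnegrE ?ler_nat ?ler0n// ltW.
  have : M * (2 `^ d) ^+ k <= M * (p%:R `^ d) ^+ k.
    by rewrite ler_wpM2l ?(le_trans ler01)// lerXn2r ?nnegrE ?powR_ge0.
  apply: le_trans; rewrite -powR_mulrn ?powR_ge0// -powRrM /powR pnatr_eq0 /=.
  have := expR_ge1Dx (d * k%:R * ln (2 : R)).
  move=> /(ler_wpM2l (le_trans ler01 M1)); apply: le_trans.
  have -> : M * (1 + d * k%:R * ln 2) = k.+1%:R + (d * ln 2)^-1 + k%:R * (d * ln 2).
    by rewrite /M -natr1; field; rewrite ?gt_eqF.
  have dl1 := ltW dl0.
  by rewrite -addrA lerDl addr_ge0 ?invr_ge0// mulr_ge0.
have Hb p k : (T <= p)%N -> k.+1%:R <= (p%:R `^ d) ^+ k :> R.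
  move=> /HT Tp; apply: (@le_trans _ _ (2 ^+ k)).
    by rewrite -natrX ler_nat ltn_expl.
  by rewrite lerXn2r ?nnegrE ?powR_ge0.
exists (M ^+ T) => [|n n0]; first by rewrite exprn_ge0// (le_trans ler01).
rewrite size_divisors natr_prod {2}(prod_prime_decomp n0) powR_prod_pfactor.
apply: (@le_trans _ _ ((\prod_(f <- prime_decomp n) (if (f.1 < T)%N then M else 1)) *
                       \prod_(f <- prime_decomp n) (f.1%:R `^ d) ^+ f.2)).
  rewrite -big_split /= !big_seq; apply: ler_prod => -[p k] pn /=.
  rewrite ler0n /=; case: ltnP => Tp; last by rewrite mul1r Hb.
  by case/mem_prime_decomp: pn => /prime_gt1 p1 _ _; exact: Hs.
rewrite ler_wpM2r//.
  by apply: prodr_ge0 => f _; rewrite exprn_ge0// powR_ge0.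
(* The exponent of [M] counts the distinct primes of n below [T], hence is at most [T]. *)
rewrite -big_mkcond big_const_seq iter_mulr_1 ler_weXn2l//.
rewrite -(count_map fst (fun p => p < T)%N) -size_filter.
rewrite -[leqRHS](size_iota 0) uniq_leq_size ?filter_uniq ?primes_uniq//.
by move=> p; rewrite mem_filter mem_iota => /andP[].
Qed.

(** * Counting multiples of q in windows *)

(** A difference of floors, put in additive form to avoid truncated subtraction. *)
Lemma sum_dvdn (q m n : nat) : (0 < q)%N -> (m <= n)%N ->
  (\sum_(m.+1 <= i < n.+1) (q %| i) + m %/ q)%N = (n %/ q)%N.
Proof.
move=> q0; elim: n => [|n IHn]; first by rewrite leqn0 => /eqP ->; rewrite big_geq.
rewrite leq_eqVlt => /predU1P[->|mn]; first by rewrite big_geq.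
by rewrite big_nat_recr//= addnAC IHn// divnS// addnC.
Qed.

Lemma sum_dvdn_shift (q n H : nat) : (0 < q)%N -> (H < n)%N ->
  (\sum_(1 <= a < H.+1) (q %| n - a) + (n.-1 - H) %/ q)%N = (n.-1 %/ q)%N.
Proof.
move=> q0; elim: H => [|H IHH] Hn; first by rewrite big_geq// subn0.
rewrite big_nat_recr//= -IHH ?(ltnW Hn)//.
have -> : (n.-1 - H = (n.-1 - H.+1).+1)%N by lia.
rewrite divnS//; have -> : ((n.-1 - H.+1).+1 = n - H.+1)%N by lia.
by rewrite addnA.
Qed.

(** The count is [H / q] plus a carry of 0 or 1. Multiplying by q keeps the comparison with H / q
    inside the natural numbers. *)
Lemma hits_small (q n H : nat) : (0 < q)%N -> (H < n)%N ->
  (q * (\sum_(1 <= a < H.+1) (q %| n - a)) <= H + q /\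
   H <= q * (\sum_(1 <= a < H.+1) (q %| n - a)) + q)%N.
Proof.
move=> q0 Hn; have := sum_dvdn_shift _ _ _ q0 Hn.
have -> : (n.-1 %/ q = ((n.-1 - H) + H) %/ q)%N by congr (_ %/ _)%N; lia.
rewrite divnD// -addnA addnC => /addnI ->.
have := divn_eq H q; have := ltn_pmod H q0.
by case: (q <= _)%N => /=; nia.
Qed.

(** [hits] is a difference of floors at n - 1 and n - 1 - H. By monotonicity these lie between the
    floors at x and x + h, and at x - H and x - H + h, whose gaps are the two sums in [err]. *)
Lemma hits_large (q x n h H : nat) : (0 < q)%N -> (H < x)%N -> (x < n <= x + h)%N ->
  let hits := (\sum_(1 <= a < H.+1) (q %| n - a))%N in
  let main := (H %/ q + (x %% q <= H %% q))%N in
  let err := ((q %| x - H) + \sum_(x.+1 <= m < (x + h).+1) (q %| m)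
     + \sum_((x - H).+1 <= m < (x - H + h).+1) (q %| m))%N in
  (hits <= main + err /\ main <= hits + err)%N.
Proof.
move=> q0 Hx /andP[xn nxh] /=.
have := sum_dvdn_shift _ _ _ q0 (ltn_trans Hx xn).
have := sum_dvdn _ _ _ q0 (leq_addr h x).
have := sum_dvdn _ _ _ q0 (leq_addr h (x - H)).
have : (x %/ q <= n.-1 %/ q <= (x + h) %/ q)%N.
  by rewrite !leq_div2r; lia.
have : ((x - H) %/ q <= (n.-1 - H) %/ q <= (x - H + h) %/ q)%N.
  by rewrite !leq_div2r; lia.
(* Adding the residues of y and H carries exactly when the residue of y + H drops below that of H;
   equality of the two residues means q divides y, and then there is no carry. *)
have key y : ((y + H) %/ q + (q %| y) = y %/ q + (H %/ q + ((y + H) %% q <= H %% q)) \/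
              (y + H) %/ q = y %/ q + (H %/ q + ((y + H) %% q <= H %% q)))%N.
  rewrite divnD// modnD// /dvdn.
  have := ltn_pmod y q0; have := ltn_pmod H q0.
  move: (y %% q)%N (H %% q)%N => t s sq tq.
  by case: (leqP q (t + s)) => tsq /=; case: (t =P 0%N) => ?; case: leqP; lia.
have := key (x - H)%N; rewrite subnK ?(ltnW Hx)//.
clear; move: (H %/ q + _)%N (x %/ q)%N (n.-1 %/ q)%N ((x + h) %/ q)%N => main a b c.
move: ((x - H) %/ q)%N ((n.-1 - H) %/ q)%N ((x - H + h) %/ q)%N => a' b' c'.
move: (nat_of_bool (q %| x - H)%N) (leq_b1 (q %| x - H)%N) => d d1.
move: (\sum_(_ <= _ < _) _)%N (\sum_(_ <= _ < _) _)%N (\sum_(_ <= _ < _) _)%N => s1 s2 s3.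
lia.
Qed.

(** * The explicit error bound at a fixed x *)

Lemma ler_dist_nat (F : numDomainType) (a b c : nat) :
  (a <= b + c)%N -> (b <= a + c)%N -> `|a%:R - b%:R| <= c%:R :> F.
Proof.
move=> abc bac; case: (leqP b a) => [ab|/ltnW ab].
  by rewrite -natrB// normr_nat ler_nat; lia.
by rewrite distrC -natrB// normr_nat ler_nat; lia.
Qed.

Lemma sum_divisors_le (V : pzRingType) (u : nat -> V) (Q m : nat) : (0 < m)%N ->
  \sum_(q <- divisors m | (q <= Q)%N) u q =
  \sum_(1 <= q < Q.+1) u q * (q %| m)%:R.
Proof.
move=> m0; under [RHS]eq_bigr do rewrite mulr_natr mulrb.
rewrite -big_mkcond -[LHS]big_filter -[RHS]big_filter; apply: perm_big.
apply: uniq_perm; rewrite ?filter_uniq ?divisors_uniq ?iota_uniq// => q.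
rewrite !mem_filter mem_index_iota -dvdn_divisors// andbC ltnS.
by case: (boolP (q %| m)%N) => //= /(dvdn_gt0 m0) ->.
Qed.

(** For each of the h values of n, four sources of error cost at most G D h each. Bounds on [u] up
    to x + h suffice: an error term has q <= h or q dividing a positive integer at most x + h. *)
Lemma correlation_bound (F : numFieldType) (u f g : nat -> F) (h H Q x : nat)
    (G B D : F) :
  (0 < h)%N -> (h <= H)%N -> (H < Q)%N -> (H < x)%N ->
  (forall m, (0 < m)%N -> g m = \sum_(1 <= q < Q.+1) u q * (q %| m)%:R) ->
  (forall q, (0 < q <= x + h)%N -> `|u q| <= G) ->
  (forall n, (x < n <= x + h)%N -> `|f n| <= B) ->
  (forall m, (0 < m <= x + h)%N -> (size (divisors m))%:R <= D) ->
  `|\sum_(1 <= a < H.+1) \sum_(x.+1 <= n < (x + h).+1) f n * g (n - a)%N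
    - (H%:R * (\sum_(1 <= q < h.+1) u q / q%:R)
       + \sum_(h.+1 <= q < H.+1) u q * (H %/ q)%:R
       + \sum_(h.+1 <= q < Q.+1 | (x %% q <= H %% q)%N) u q)
      * \sum_(x.+1 <= n < (x + h).+1) f n|
  <= 4 * (B * G * D * h%:R ^+ 2).
Proof.
move=> h0 hH HQ Hx gE uG fB sD.
have G0 : 0 <= G by apply: le_trans (normr_ge0 _) (uG 1%N _); lia.
have D1 : 1 <= D by apply: le_trans (sD 1%N _); rewrite // addn_gt0 h0 orbT.
have uD m : (0 < m <= x + h)%N ->
    \sum_(1 <= q < Q.+1) `|u q| * (q %| m)%:R <= G * D.
  move=> /[dup] mxh /andP[m0 mx]; rewrite -sum_divisors_le//.
  apply: (@le_trans _ _ (\sum_(q <- divisors m) G)); last first.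
    by rewrite big_const_seq count_predT iter_addr_0 -mulr_natr ler_wpM2l// sD.
  rewrite big_mkcond big_seq [leRHS]big_seq ler_sum// => q.
  rewrite -dvdn_divisors// => qm; case: ifP => // _; apply: uG.
  by rewrite (dvdn_gt0 m0 qm) (leq_trans (dvdn_leq m0 qm)).
pose hits q n := (\sum_(1 <= a < H.+1) (q %| n - a))%N.
pose main q : F := if (q <= h)%N then H%:R / q%:R
                   else (H %/ q + (x %% q <= H %% q))%N%:R.
have -> : \sum_(1 <= a < H.+1) \sum_(x.+1 <= n < (x + h).+1) f n * g (n - a)%N =
    \sum_(x.+1 <= n < (x + h).+1) f n * \sum_(1 <= q < Q.+1) u q * (hits q n)%:R.
  rewrite exchange_big_nat /=; apply: eq_big_nat => n /andP[xn _].
  rewrite -big_distrr /=; congr (_ * _).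
  under [RHS]eq_bigr do rewrite natr_sum big_distrr /=.
  rewrite exchange_big_nat /=; apply: eq_big_nat => a /andP[_ aH].
  by rewrite gE//; lia.
have -> : H%:R * (\sum_(1 <= q < h.+1) u q / q%:R)
       + \sum_(h.+1 <= q < H.+1) u q * (H %/ q)%:R
       + \sum_(h.+1 <= q < Q.+1 | (x %% q <= H %% q)%N) u q =
    \sum_(1 <= q < Q.+1) u q * main q.
  rewrite (@big_cat_nat _ _ _ h.+1 1 Q.+1) //=; last by lia.
  rewrite -addrA; congr (_ + _).
    rewrite big_distrr /=; apply: eq_big_nat => q /andP[_ qh].
    by rewrite /main -ltnS qh mulrCA.
  (* The range extends to Q because [H / q] = 0 for q > H; both sums over q > h then merge into
     one. *)
  have -> : \sum_(h.+1 <= q < H.+1) u q * (H %/ q)%:R =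
      \sum_(h.+1 <= q < Q.+1) u q * (H %/ q)%:R.
    rewrite (@big_cat_nat _ _ _ H.+1 h.+1 Q.+1) //=; last by lia.
    rewrite [X in _ = _ + X]big1_seq ?addr0// => q /andP[_].
    by rewrite mem_index_iota => /andP[Hq _]; rewrite divn_small// mulr0.
  rewrite [X in _ + X]big_mkcond -big_split /=.
  apply: eq_big_nat => q /andP[hq _].
  rewrite /main (leqNgt q h) hq /= natrD mulrDr; congr (_ + _).
  by case: leqP; rewrite ?mulr1 ?mulr0.
have hits_main n : (x < n <= x + h)%N ->
    `|\sum_(1 <= q < Q.+1) u q * ((hits q n)%:R - main q)| <= 4 * (G * D * h%:R).
  move=> nxh.
  (* The first term pays the error of at most 1 for q <= h; the other three are the parts of [err]
     in [hits_large]. *)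
  apply: (@le_trans _ _ (\sum_(1 <= q < Q.+1) (`|u q| * (q <= h)%:R
     + `|u q| * (q %| x - H)%:R
     + \sum_(x.+1 <= m < (x + h).+1) `|u q| * (q %| m)%:R
     + \sum_((x - H).+1 <= m < (x - H + h).+1) `|u q| * (q %| m)%:R))).
    apply: le_trans (ler_norm_sum _ _ _) _; apply: ler_sum_nat => q /andP[q0 qQ].
    rewrite -!big_distrr -!mulrDr normrM ler_wpM2l//= -!natr_sum -!natrD /main.
    case: ifP => qh.
      apply: (@le_trans _ _ 1); last by rewrite ler1n; lia.
      have q0' : 0 < q%:R :> F by rewrite ltr0n.
      rewrite -(ler_pM2l q0') mulr1 -{1}(gtr0_norm q0') -normrM mulrBr.
      rewrite mulrCA divff ?gt_eqF// mulr1 -natrM.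
      by have [] := @hits_small q n H q0; [lia|exact: ler_dist_nat].
    have [] := hits_large _ _ _ _ _ q0 Hx nxh => h1 h2.
    by rewrite /hits; apply: ler_dist_nat; move: h1 h2; lia.
  rewrite !big_split /= [X in _ + X + _]exchange_big_nat [X in _ + X]exchange_big_nat /=.
  have b1 : \sum_(1 <= q < Q.+1) `|u q| * (q <= h)%:R <= G * D * h%:R.
    rewrite (@big_cat_nat _ _ _ h.+1 1 Q.+1) //=; last by lia.
    rewrite [X in _ + X]big1_seq ?addr0; last first.
      by move=> q; rewrite mem_index_iota => /and3P[_ hq _]; rewrite leqNgt hq mulr0.
    apply: (@le_trans _ _ (\sum_(1 <= q < h.+1) G)).
      apply: ler_sum_nat => q /andP[q0 qh]; rewrite -ltnS qh mulr1 uG//; lia.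
    rewrite sumr_const_nat subSS subn0 -[leLHS]mulr_natr ler_wpM2r//.
    by rewrite -[leLHS]mulr1 ler_wpM2l.
  have GD0 : 0 <= G * D by rewrite mulr_ge0// (le_trans ler01).
  have b2 : \sum_(1 <= q < Q.+1) `|u q| * (q %| x - H)%:R <= G * D * h%:R.
    apply: (@le_trans _ _ (G * D)); first by apply: uD; lia.
    by rewrite -[leLHS]mulr1 ler_wpM2l// ler1n.
  (* Used for y = x and y = x - H: each window holds h integers m, each costing at most G D by
     [uD]. *)
  have b3 y : (y <= x)%N -> \sum_(y.+1 <= m < (y + h).+1)
      \sum_(1 <= q < Q.+1) `|u q| * (q %| m)%:R <= G * D * h%:R.
    move=> yx; apply: (@le_trans _ _ (\sum_(y.+1 <= m < (y + h).+1) (G * D))).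
      by apply: ler_sum_nat => m /andP[ym my]; apply: uD; lia.
    by rewrite sumr_const_nat -[leLHS]mulr_natr subSS addKn.
  have -> : 4 * (G * D * h%:R) =
    G * D * h%:R + G * D * h%:R + G * D * h%:R + G * D * h%:R by ring.
  by rewrite !lerD// b3// leq_subr.
rewrite mulrC big_distrl -sumrB /=.
under eq_bigr => n _ do rewrite -mulrBr -sumrB /=.
under eq_bigr => n _ do under eq_bigr => q _ do rewrite -mulrBr.
apply: le_trans (ler_norm_sum _ _ _) _.
apply: (@le_trans _ _ (\sum_(x.+1 <= n < (x + h).+1) (B * (4 * (G * D * h%:R))))).
  by apply: ler_sum_nat => n nxh; rewrite normrM ler_pM// ?fB ?hits_main.
rewrite sumr_const_nat subSS addKn -[leLHS]mulr_natr.
by have -> : B * (4 * (G * D * h%:R)) * h%:R = 4 * (B * G * D * h%:R ^+ 2) by ring.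
Qed.

(** * Real floors and the asymptotic statement *)

Lemma floor_divn (R : realType) (m q : nat) : (0 < q)%N ->
  Num.floor (m%:R / q%:R : R) = (m %/ q)%:Z.
Proof.
move=> q0; have q0R : 0 < q%:R :> R by rewrite ltr0n.
apply: floor_def; rewrite ler_pdivlMr// ltr_pdivrMr// intrD mulr1z -pmulrn natr1.
by rewrite -!natrM ler_nat ltr_nat leq_divM ltn_ceil.
Qed.

Lemma frac_part_divn (R : realType) (m q : nat) : (0 < q)%N ->
  frac_part (m%:R / q%:R : R) = (m %% q)%:R / q%:R.
Proof.
move=> q0; have q0R : q%:R != 0 :> R by rewrite pnatr_eq0 -lt0n.
rewrite /frac_part floor_divn// -pmulrn {1}(divn_eq m q) natrD natrM.
by field.
Qed.

Theorem theorem1 (R : realType) (f : nat -> R[i]) (B : R -> R) (K : R)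
    (e : R) :
  essentially_bounded f -> 0 < e ->
  exists C : R,
    forall (h H Q : nat -> nat) (g : nat -> nat -> R[i]),
      (forall x, (0 < x)%N -> [&& 0 < h x, h x <= H x & H x < Q x]%N) ->
      (\forall x \near \oo, (Q x)%:R <= K * x%:R) ->
      (fun x => (H x)%:R : R^o) =o_\oo (fun x => x%:R : R^o) ->
      (forall x, (0 < x)%N -> sieve_function B (Q x) (g x)) ->
      \forall x \near \oo,
        `| \sum_(1 <= a < (H x).+1) \sum_(x.+1 <= n < (x + h x).+1)
             f n * g x (n - a)%N
           - ((H x)%:R * (\sum_(1 <= q < (h x).+1) eratosthenes (g x) q / q%:R)
              + \sum_((h x).+1 <= q < (H x).+1)
                  eratosthenes (g x) q * (Num.floor ((H x)%:R / q%:R : R))%:~R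
              + \sum_((h x).+1 <= q < (Q x).+1 |
                     frac_part (x%:R / q%:R : R)
                       <= frac_part ((H x)%:R / q%:R : R))
                  eratosthenes (g x) q)
             * \sum_(x.+1 <= n < (x + h x).+1) f n |
        <= (C * x%:R `^ e * (h x)%:R ^+ 2)%:C.
Proof.
(* Three factors each cost x ^ d: the values of [f], the Eratosthenes transform and the divisor
   count. *)
move=> fbd e0; pose d := e / 3; have d0 : 0 < d by rewrite divr_gt0.
have [A fA] := fbd d d0.
have [D D0 sD] := divisor_bound R d d0.
(* The arguments reach x + h <= 2 x, whence 2 ^ d; absolute values are taken since [A] and [B d]
   carry no sign assumption. *)
pose A' := `|A| * 2 `^ d; pose B' := `|B d| * 2 `^ d; pose D' := D * 2 `^ d.
exists (4 * (A' * B' * D')) => h H Q g hHQ _ /eqoP Ho gS.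
have H2 : \forall x \near \oo, `|(H x)%:R : R^o| <= 2^-1 * `|x%:R : R^o|.
  by apply: Ho; rewrite invr_gt0.
have [N _ fN] := fA.
near=> x.
have x0 : (0 < x)%N by near: x; exact: nbhs_infty_gt.
have Nx : (N <= x)%N by near: x; exact: nbhs_infty_ge.
(* The little-o hypothesis with constant 1/2 gives H < x, so every n - a is positive and x + h <= 2
   x. *)
have Hx : (H x < x)%N.
  have : `|(H x)%:R : R^o| <= 2^-1 * `|x%:R : R^o| by near: x.
  rewrite !normr_nat mulrC ler_pdivlMr// -natrM ler_nat; lia.
have /and3P[h0 hH HQ] := hHQ x x0.
have [gE _ uB] := gS x x0.
have hx : (x + h x <= 2 * x)%N by lia.
set u := eratosthenes (g x) in gE uB *.
have le2x (c : R) n : (n <= x + h x)%N -> c * n%:R `^ d <= `|c| * 2 `^ d * x%:R `^ d.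
  move=> nx; apply: (@le_trans _ _ (`|c| * n%:R `^ d)).
    by rewrite ler_wpM2r ?powR_ge0 ?ler_norm.
  rewrite -mulrA -powRM ?ler0n// -natrM ler_wpM2l//.
  by rewrite ge0_ler_powR ?(ltW d0) ?nnegrE ?ler0n// ler_nat (leq_trans nx).
have fB n : (x < n <= x + h x)%N -> `|f n| <= (A' * x%:R `^ d)%:C.
  move=> /andP[xn nx]; apply: le_trans (fN n _) _; first by rewrite /=; lia.
  by rewrite lecR le2x.
have uG q : (0 < q <= x + h x)%N -> `|u q| <= (B' * x%:R `^ d)%:C.
  move=> /andP[q0 qx]; apply: le_trans (uB d d0 q q0) _.
  by rewrite lecR le2x.
have sD' m : (0 < m <= x + h x)%N ->
    (size (divisors m))%:R <= (D' * x%:R `^ d)%:C :> R[i].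
  move=> /andP[m0 mx]; rewrite -(rmorph_nat (real_complex R)) lecR.
  by apply: le_trans (sD m m0) _; rewrite /D' -{2}(ger0_norm D0) le2x.
have gE' m : (0 < m)%N -> g x m = \sum_(1 <= q < (Q x).+1) u q * (q %| m)%:R.
  by move=> m0; rewrite gE// sum_divisors_le.
have := correlation_bound _ _ _ _ _ _ _ _ _ _ _ h0 hH HQ Hx gE' uG fB sD'.
set P := x%:R `^ d.
have -> : 4 * ((A' * P)%:C * (B' * P)%:C * (D' * P)%:C * (h x)%:R ^+ 2) =
    (4 * (A' * B' * D') * x%:R `^ e * (h x)%:R ^+ 2)%:C.
  rewrite -(rmorph_nat (real_complex R) 4) -(rmorph_nat (real_complex R) (h x)).
  rewrite -rmorphXn -!rmorphM; congr (_%:C).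
  have -> : e = d * 3%:R by rewrite /d divfK.
  by rewrite powRrM powR_mulrn ?powR_ge0// /P; ring.
congr (`|_ - (_ + _ + _) * _| <= _).
  apply: eq_big_nat => q /andP[hq _].
  by rewrite floor_divn ?(leq_trans _ hq)// -pmulrn.
(* Both fractional parts are residues over the same denominator q, so comparing them is comparing
   residues. *)
rewrite big_nat_cond [RHS]big_nat_cond; apply: eq_bigl => q.
case: (boolP (_ <= q < _)%N) => //= /andP[hq _].
have q0 : (0 < q)%N by rewrite (leq_trans _ hq).
by rewrite !frac_part_divn// ler_pM2r ?ler_nat// invr_gt0 ltr0n.
Unshelve. all: by end_near.
Qed.
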